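(* Fix $w$, $x$, $y$ and $\epsilon$. Let $\gamma_i(y_i)$, for $i=1,\dots,n$ and each possible value $y_i$ of the $i$-th coordinate, be i.i.d. real random variables with a smooth probability density function. Then, with probability one over $\gamma$, the set of maximal arguments $$\arg\max_{\hat y\in Y}\Big\{\sum_{\alpha\in\mathcal A}\mu_{w,\alpha}(x,\hat y_\alpha)+\sum_{i=1}^n\gamma_i(\hat y_i)+\epsilon\,\ell(y,\hat y)\Big\}$$ consists of a single structure.
   Context: $Y$ is a finite nonempty set of structured labels $y=(y_1,\dots,y_n)$, where each coordinate $y_i$ ranges over a finite set. $\mathcal A$ is a collection of subsets $\alpha\subset\{1,\dots,n\}$, and $y_\alpha=(y_i)_{i\in\alpha}$. The score of a structure is $\mu_w(x,y)=\sum_{\alpha\in\mathcal A}\mu_{w,\alpha}(x,y_\alpha)$ with real-valued local score functions $\mu_{w,\alpha}$ parametrized by $w$; $\ell:Y\times Y\to\mathbb R$ is a loss function and $\epsilon\in\mathbb R$. There is one random variable $\gamma_i(y_i)$ for each index $i$ and each value $y_i$. *)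

(* Defs.v *)
From HB Require Import structures.
From mathcomp Require Import all_boot all_order all_algebra.
From mathcomp Require Import all_classical all_reals all_analysis.

Set Implicit Arguments.
Unset Strict Implicit.
Unset Printing Implicit Defensive.

Import Order.TTheory GRing.Theory Num.Theory.
Import numFieldNormedType.Exports.

Local Open Scope classical_set_scope.
Local Open Scope ring_scope.

(* Coordinates are 0-based: [y i] for [i : 'I_n] is the coordinate y_(i+1),
   with values in its own finite alphabet [V i]. *)
Definition labeling (n : nat) (V : 'I_n -> finType) : finType :=
  {dffun forall i : 'I_n, V i}.

Definition sublabeling (n : nat) (V : 'I_n -> finType) (alpha : {set 'I_n}) :
    finType :=
  {dffun forall i : {i : 'I_n | i \in alpha}, V (val i)}.

Definition sub_label (n : nat) (V : 'I_n -> finType) (alpha : {set 'I_n})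
    (y : labeling V) : sublabeling V alpha :=
  [ffun i : {i : 'I_n | i \in alpha} => y (val i)].

Definition score (R : realType) (n : nat) (V : 'I_n -> finType)
    (A : {set {set 'I_n}})
    (loc : forall alpha : {set 'I_n}, sublabeling V alpha -> R)
    (y : labeling V) : R :=
  \sum_(alpha in A) loc alpha (sub_label alpha y).

Definition argmax (R : realType) (T : finType) (Y : {set T}) (F : T -> R) :
    {set T} :=
  [set y in Y | [forall z in Y, F z <= F y]]%SET.

Definition smooth (R : realType) (f : R -> R) : Prop :=
  forall (k : nat) (t : R), derivable (f^`(k))%classic t 1.

Definition is_pdf (R : realType) (f : R -> R) : Prop :=
  [/\ measurable_fun setT f,
      forall t, 0 <= f t
    & (\int[@lebesgue_measure R]_(t in setT) (f t)%:E = 1)%E].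

Definition has_density (R : realType) (d : measure_display)
    (T : measurableType d) (P : probability T R)
    (X : {RV P >-> R}) (f : R -> R) : Prop :=
  forall B : set R, measurable B ->
    distribution P X B = (\int[@lebesgue_measure R]_(t in B) (f t)%:E)%E.

Definition mutually_independent (R : realType) (d : measure_display)
    (T : measurableType d) (P : probability T R)
    (I : finType) (X : I -> {RV P >-> R}) : Prop :=
  forall (J : {set I}) (B : I -> set R), (forall i, measurable (B i)) ->
    P (\bigcap_(i in [set` J]) (X i @^-1` B i))
      = (\prod_(i in J) P (X i @^-1` B i))%E.

Definition identically_distributed (R : realType) (d : measure_display)
    (T : measurableType d) (P : probability T R)
    (I : finType) (X : I -> {RV P >-> R}) : Prop :=
  forall (i j : I) (B : set R), measurable B ->
    distribution P (X i) B = distribution P (X j) B.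

Definition iid (R : realType) (d : measure_display)
    (T : measurableType d) (P : probability T R)
    (I : finType) (X : I -> {RV P >-> R}) : Prop :=
  mutually_independent X /\ identically_distributed X.

(* Main.v *)
(* Two distinct structures [z] and [z'] differ in some coordinate [i], so the
   event that their perturbed scores coincide reads
   [gamma (i, z i) = g (gamma)], where [g] does not involve [gamma (i, z i)].
   That variable has a density and is independent of the others, so the event
   is null, and there are finitely many pairs of structures. *)
Require Import Defs.
From HB Require Import structures.
From mathcomp Require Import all_boot all_order all_algebra.
From mathcomp Require Import all_classical all_reals all_analysis.
From mathcomp Require Import measurable_realfun lra.

Set Implicit Arguments.
Unset Strict Implicit.
Unset Printing Implicit Defensive.

Import Order.TTheory GRing.Theory Num.Theory.
Import numFieldNormedType.Exports.

Local Open Scope classical_set_scope.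
Local Open Scope ring_scope.

Section independence.
Context (R : realType) (d : measure_display) (T : measurableType d).
Context (P : probability T R).

(** Absolute continuity of the integral: [f] is integrable, being nonnegative with integral 1, so
    its integral over a set of small Lebesgue measure is small. *)
Lemma density_small_sets (X : {RV P >-> R}) (f : R -> R) (e : R) :
  is_pdf f -> has_density X f -> 0 < e ->
  exists2 r : R, 0 < r & forall J : set R, measurable J ->
    (lebesgue_measure J < r%:E)%E -> (P (X @^-1` J) <= e%:E)%E.
Proof.
move=> [mf f_ge0 f_int1] Xf e_gt0.
have fE J : (\int[@lebesgue_measure R]_(t in J) `|(f t)%:E|
    = \int[@lebesgue_measure R]_(t in J) (f t)%:E)%E.
  by apply: eq_integral => t _; rewrite gee0_abs// lee_fin.
have f_int : (@lebesgue_measure R).-integrable setT (EFin \o f).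
  apply/integrableP; split; first exact/measurable_EFinP.
  by rewrite fE f_int1 ltry.
have [r [r_gt0 fr]] := integral_normr_continuous f_int e_gt0.
exists r => // J mJ /(fr _ mJ)/ltW; rewrite -lee_fin.
have -> : P (X @^-1` J) = distribution P X J by [].
rewrite Xf// /Rintegral.
have fJ : (\int[@lebesgue_measure R]_(t in J) (f t)%:E \is a fin_num)%E.
  by rewrite -Xf// fin_num_measure.
have -> : (\int[@lebesgue_measure R]_(t in J) `|f t|%:E
    = \int[@lebesgue_measure R]_(t in J) (f t)%:E)%E.
  by apply: eq_integral => t _; rewrite ger0_norm.
by rewrite fineK.
Qed.

(** Split [E] along the countably many values of [K]. On [K = k] the event forces [X] into [J k], so
    by independence this piece has mass at most [e * P (K = k)], and these bounds sum to [e]. *)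
Lemma measure_le_of_discretization (C : countType) (K : T -> C)
    (X : T -> R) (J : C -> set R) (E : set T) (e : R) :
  (forall k, measurable [set w | K w = k]) ->
  (forall k, measurable (X @^-1` J k)) ->
  (forall k, P (X @^-1` J k `&` [set w | K w = k])
    = (P (X @^-1` J k) * P [set w | K w = k])%E) ->
  (forall k, (P (X @^-1` J k) <= e%:E)%E) ->
  measurable E -> (forall w, E w -> J (K w) (X w)) ->
  (P E <= e%:E)%E.
Proof.
move=> mK mJ PJK PJ mE EJ.
have e_ge0 : 0 <= e.
  (* Any outcome [w] gives a probability bounded by [e], and an empty [T] could not have mass 1. *)
  case: (pselect (exists w : T, True)) => [[w _]|noT].
    by rewrite -lee_fin (le_trans _ (PJ (K w))).
  have : P [set: T] = 1%E by exact: probability_setT.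
  rewrite (_ : [set: T] = set0) ?measure0 => [/eqP|].
    by rewrite eq_sym onee_eq0.
  by apply/seteqP; split => // w _; case: noT; exists w.
(* The level sets of [K] are indexed by natural numbers through [pickle]; [F n] is empty when [n]
   codes no attained value. *)
pose F n := (pickle \o K) @^-1` [set n].
have FE n : F n = set0 \/ exists k, F n = [set w | K w = k].
  case: (pselect (exists w, F n w)) => [[w <-]|noF]; [right|left].
    exists (K w); apply/seteqP; split=> w'; last by rewrite /F /= => ->.
    exact: (pcan_inj pickleK).
  by apply/seteqP; split=> // w Fw; apply: noF; exists w.
have mF n : measurable (F n) by case: (FE n) => [->|[k ->]].
have F_cover : \bigcup_n F n = setT.
  by apply/seteqP; split=> // w _; exists (pickle (K w)).
have PEF n : (P (E `&` F n) <= e%:E * P (F n))%E.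
  case: (FE n) => [->|[k ->]]; first by rewrite setI0 measure0 mule0.
  apply: (@le_trans _ _ (P (X @^-1` J k `&` [set w | K w = k]))).
    apply: le_measure; rewrite ?inE; [exact: measurableI..|].
    by move=> w [/EJ Jw /= <-].
  by rewrite PJK; apply: lee_wpmul2r.
apply: (@le_trans _ _ (\sum_(0 <= n <oo) P (E `&` F n))%E).
  apply: measure_sigma_subadditive => // [n|].
    exact: measurableI.
  by rewrite -setI_bigcupr F_cover setIT.
apply: (@le_trans _ _ (\sum_(0 <= n <oo) (e%:E * P (F n)))%E).
  exact: lee_nneseries.
rewrite nneseriesZl//.
have -> : (\sum_(0 <= n <oo) P (F n) = 1)%E.
  rewrite -(@probability_setT _ _ _ P) -F_cover measure_semi_bigcup//.
    exact: trivIset_preimage1.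
  by rewrite F_cover; exact: measurableT.
by rewrite mule1.
Qed.

(** Apply the product formula to all of [I] and to [I] without [i], for the family [B'] that has [J]
    at [i]: the two products differ by the factor at [i]. *)
Lemma mutually_independent_setD1 (I : finType) (X : I -> {RV P >-> R})
    (i : I) (J : set R) (B : I -> set R) :
  mutually_independent X -> measurable J -> (forall j, measurable (B j)) ->
  P (X i @^-1` J `&` \bigcap_(j in [set j | j != i]) (X j @^-1` B j))
    = (P (X i @^-1` J) * P (\bigcap_(j in [set j | j != i]) (X j @^-1` B j)))%E.
Proof.
move=> indX mJ mB.
pose B' j := if j == i then J else B j.
have mB' j : measurable (B' j) by rewrite /B'; case: ifP.
have -> : \bigcap_(j in [set j | j != i]) (X j @^-1` B j)
    = \bigcap_(j in [set` ([set: I] :\ i)%SET]) (X j @^-1` B' j).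
  apply/seteqP; split=> w Bw j /=.
    by rewrite !inE andbT => ji; rewrite /B' (negbTE ji); exact: Bw.
  by move=> ji; have := Bw j; rewrite /B' (negbTE ji) /= !inE ji; exact.
have -> : X i @^-1` J `&`
      \bigcap_(j in [set` ([set: I] :\ i)%SET]) (X j @^-1` B' j)
    = \bigcap_(j in [set` [set: I]%SET]) (X j @^-1` B' j).
  apply/seteqP; split=> [w [Jw Bw] j _ /=|w Bw].
    have [->|ji] := eqVneq j i; first by rewrite /B' eqxx.
    by apply: Bw; rewrite /= !inE ji.
  split; last by move=> j _; apply: Bw; rewrite /= inE.
  by have := Bw i; rewrite /B' eqxx /= inE; exact.
by rewrite !indX// (big_setD1 i) ?inE//= {1}/B' eqxx.
Qed.

(* Round the variables other than [X i] to the grid of mesh [r]: the event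
   then forces [X i] into a short interval determined by the rounded values,
   which are independent of [X i]. *)
Lemma independent_graph_null (I : finType) (X : I -> {RV P >-> R})
    (f : R -> R) (i : I) (g : (I -> R) -> R) :
  mutually_independent X -> is_pdf f -> has_density (X i) f ->
  (forall e : R, 0 < e -> exists2 r : R, 0 < r & forall u v : I -> R,
    (forall j, j != i -> `|u j - v j| <= r) -> `|g u - g v| <= e) ->
  measurable [set w | X i w = g (X^~ w)] ->
  P [set w | X i w = g (X^~ w)] = 0%E.
Proof.
move=> indX f_pdf Xf g_unif mE; apply/eqP; rewrite eq_le measure_ge0 andbT.
apply/lee_addgt0Pr => e e_gt0; rewrite add0e.
have [l l_gt0 Pl] := density_small_sets f_pdf Xf e_gt0.
(* With tolerance [l / 3] on each side, the interval [J k] has length [2 * l / 3], strictly below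
   [l]. *)
have [r r_gt0 gr] : exists2 r : R, 0 < r & forall u v : I -> R,
    (forall j, j != i -> `|u j - v j| <= r) -> `|g u - g v| <= l / 3.
  by apply: g_unif; rewrite divr_gt0.
(* Coordinate [i] is sent to the constant 0, so that [K] carries no information on [X i]; the centre
   [c k] still makes sense because the bound on [g] holds whatever the arguments at [i] are. *)
pose q j (t : R) : int := if j == i then 0 else Num.floor (t / r).
pose K w := [ffun j => q j (X j w)].
pose c (k : {ffun I -> int}) := g (fun j => (k j)%:~R * r).
pose J k := `[c k - l / 3, c k + l / 3]%classic.
have mq j k : measurable [set t | q j t = k].
  rewrite /q; case: (j == i).
    have [->|k0] := eqVneq k 0.
      by rewrite (_ : mkset _ = setT); [exact: measurableT|apply/seteqP; split].
    rewrite (_ : mkset _ = set0); first exact: measurable0.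
    by apply/seteqP; split=> // t /= /eqP; rewrite eq_sym (negbTE k0).
  rewrite (_ : mkset _ = `[k%:~R * r, (k + 1)%:~R * r[%classic).
    exact: measurable_itv.
  apply/seteqP; split=> t /=; rewrite in_itv/= -ler_pdivlMr// -ltr_pdivrMr//.
    by move/eqP; rewrite floor_eq.
  by rewrite -floor_eq => /eqP.
have mX j B : measurable B -> measurable (X j @^-1` B).
  by move=> mB; rewrite -[_ @^-1` _]setTI; exact: measurable_funPT.
have mJ k : measurable (X i @^-1` J k) by apply: mX; exact: measurable_itv.
(* The level set is empty if [k i] is nonzero; otherwise it is an event in the variables other than
   [X i]. *)
have KE k : [set w | K w = k] = set0 \/ [set w | K w = k]
    = \bigcap_(j in [set j | j != i]) (X j @^-1` [set t | q j t = k j]).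
  have [ki|ki] := eqVneq (k i) 0; [right|left]; apply/seteqP; split=> w //=.
  - by move=> <- j /= ji; rewrite /K ffunE.
  - move=> kw; apply/ffunP => j; rewrite ffunE.
    by have [->|ji] := eqVneq j i; [rewrite /q eqxx ki|exact: kw].
  - by move=> Kk; move: ki; rewrite -Kk ffunE /q eqxx eqxx.
apply: (@measure_le_of_discretization _ K (X i) J) => //.
- move=> k; case: (KE k) => [->|->]; first exact: measurable0.
  apply: fin_bigcap_measurable => [|j _]; first exact: finite_finset.
  by apply: mX; exact: mq.
- move=> k; case: (KE k) => [->|->]; first by rewrite setI0 measure0 mule0.
  by apply: mutually_independent_setD1 => //; exact: measurable_itv.
- move=> k; apply: Pl; first exact: measurable_itv.
  rewrite lebesgue_measure_itv /=; case: ifP => // _.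
  by rewrite -EFinD lte_fin; lra.
(* Each rounded variable is within one mesh [r] of its value, so [g] moves by at most [l / 3]. *)
- move=> w /= Xg; rewrite /J /= in_itv /= -ler_distl Xg; apply: gr => j ji.
  rewrite ffunE /q (negbTE ji).
  have /andP[] := floor_itv (X j w / r).
  rewrite ler_pdivlMr// ltr_pdivrMr// rmorphD /= mulrDl mul1r => lo hi.
  by rewrite ler_norml; apply/andP; split; lra.
Qed.

End independence.

(** A maximiser exists because [Y] is finite and nonempty; two maximisers have equal values, hence
    coincide. *)
Lemma argmax_inj_on (R : realType) (T : finType) (Y : {set T}) (F : T -> R) :
  Y != finset.set0 ->
  (forall z z', z \in Y -> z' \in Y -> z != z' -> F z <> F z') ->
  exists z, argmax Y F = [set z]%SET.
Proof.
move=> /set0Pn[z0 z0Y] F_inj.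
case: (@arg_maxP _ _ _ z0 (mem Y) F z0Y) => z zY z_max; exists z.
apply/setP => t; rewrite !inE; apply/andP/eqP => [[tY /forall_inP t_max]|->].
  apply: contrapT => /eqP tz; apply: (F_inj t z) => //.
  by apply/le_anti/andP; split; [exact: z_max|exact: t_max].
by split=> //; apply/forall_inP => t' /z_max.
Qed.

Theorem theorem2 (R : realType) (n : nat) (V : 'I_n -> finType)
    (Y : {set labeling V}) (Y_neq0 : Y != finset.set0)
    (A : {set {set 'I_n}})
    (W X : Type)
    (mu : W -> forall alpha : {set 'I_n}, X -> sublabeling V alpha -> R)
    (loss : labeling V -> labeling V -> R)
    (w : W) (x : X) (y : labeling V) (yY : y \in Y) (eps : R)
    (d : measure_display) (Omega : measurableType d) (P : probability Omega R)
    (gamma : {i : 'I_n & V i} -> {RV P >-> R})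
    (gamma_iid : iid gamma)
    (f : R -> R) (f_pdf : is_pdf f) (f_smooth : smooth f)
    (gamma_f : forall iv : {i : 'I_n & V i}, has_density (gamma iv) f) :
  \forall omega \ae P,
    exists yh : labeling V,
      argmax Y (fun z : labeling V =>
        score A (fun alpha => mu w alpha x) z
        + \sum_(i < n) gamma (Tagged V (z i)) omega
        + eps * loss y z) = [set yh]%SET.
Proof.
pose F z omega := score A (fun alpha => mu w alpha x) z
  + \sum_(i < n) gamma (Tagged V (z i)) omega + eps * loss y z.
(* There are finitely many pairs, so [filter_forall] reduces the claim to one pair at a time. *)
suff : \forall omega \ae P, forall zz : labeling V * labeling V,
    zz.1 != zz.2 -> F zz.1 omega <> F zz.2 omega.
  apply: filterS => omega F_neq; apply: argmax_inj_on => // z z' _ _.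
  exact: (F_neq (z, z')).
apply: filter_forall => -[z z'] /=.
have [->|zz'] := eqVneq z z'; first by apply: nearW => omega.
have mF u : measurable_fun setT (F u).
  apply: measurable_funD => //; apply: measurable_funD => //.
  by apply: measurable_sum => i; exact: measurable_funPT.
have [i zi] : exists i, z i != z' i.
  apply/existsP; apply: contraNT zz'; rewrite negb_exists => /forallP eqz.
  by apply/eqP/ffunP => i; apply/eqP; have := eqz i; rewrite negbK.
(* This is [F z = F z'] solved for [gamma (i, z i)], hence the missing term [j = i] in the last
   sum. *)
pose g (u : {i : 'I_n & V i} -> R) :=
  score A (fun alpha => mu w alpha x) z' + eps * loss y z'
  - score A (fun alpha => mu w alpha x) z - eps * loss y z
  + \sum_j u (Tagged V (z' j)) - \sum_(j | j != i) u (Tagged V (z j)).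
have FE : [set omega | F z omega = F z' omega]
    = [set omega | gamma (Tagged V (z i)) omega = g (gamma^~ omega)].
  by apply/seteqP; split=> omega /=;
     rewrite /F /g [X in _ + X + eps * loss y z](bigD1 i)//=; lra.
have mE : measurable [set omega | F z omega = F z' omega].
  rewrite (_ : mkset _ = (F z \- F z') @^-1` [set 0]).
    by rewrite -[_ @^-1` _]setTI; apply: (measurable_funB (mF z) (mF z')).
  by apply/seteqP; split=> omega /= => [->|/subr0_eq//]; rewrite subrr.
have g_unif (e : R) : 0 < e -> exists2 r : R, 0 < r &
    forall u v : {i : 'I_n & V i} -> R,
    (forall j, j != Tagged V (z i) -> `|u j - v j| <= r) -> `|g u - g v| <= e.
  (* The two sums in [g] have at most [2 * n] terms, each moving by at most [r]; [n.+1] keeps the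
     divisor positive without a case on [n]. *)
  move=> e_gt0; exists (e / (n.+1%:R *+ 2)); first by rewrite divr_gt0.
  set r := _ / _ => u v uv.
  have r_ge0 : 0 <= r by rewrite divr_ge0// ltW.
  have sum_le (Q : pred 'I_n) (t : labeling V) :
      (forall j, Q j -> Tagged V (t j) != Tagged V (z i)) ->
      `|\sum_(j | Q j) u (Tagged V (t j)) - \sum_(j | Q j) v (Tagged V (t j))|
        <= n%:R * r.
    move=> Qt; rewrite -sumrB (le_trans (ler_norm_sum _ _ _))//.
    apply: (@le_trans _ _ (\sum_(j < n | Q j) r)).
      by apply: ler_sum => j /Qt; exact: uv.
    rewrite big_mkcond /= (le_trans (_ : _ <= \sum_(j < n) r))//.
      by apply: ler_sum => j _; case: ifP.
    by rewrite sumr_const card_ord mulr_natl.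
  have : `|\sum_j u (Tagged V (z' j)) - \sum_j v (Tagged V (z' j))| <= n%:R * r.
    (* The sum over [z'] keeps its term at [i], but [z' i] differs from [z i], so it reads another
       variable than [gamma (i, z i)]. *)
    apply: sum_le => j _; apply: contra zi => /eqP zz.
    have ji : j = i by have := congr1 tag zz.
    by subst j; rewrite (eq_from_Tagged zz).
  have : `|\sum_(j | j != i) u (Tagged V (z j))
         - \sum_(j | j != i) v (Tagged V (z j))| <= n%:R * r.
    by apply: sum_le => j; apply: contra => /eqP/(congr1 tag)/= ->.
  have : n%:R * r *+ 2 <= e.
    have -> : e = r * (n.+1%:R *+ 2) by rewrite divfK.
    by rewrite -natr1; lra.
  rewrite /g !ler_norml => ne /andP[? ?] /andP[? ?].
  by apply/andP; split; lra.
exists [set omega | F z omega = F z' omega]; split=> //.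
  rewrite FE; apply: (independent_graph_null gamma_iid.1 f_pdf) => //.
  by rewrite -FE.
by move=> omega /= /not_implyP[_ /contrapT].
Qed.
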